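(* Let $C_1$ and $C_2$ be two non-c-archimedean discrete abelian cyclically ordered groups such that $C_1/\langle 1_{C_1}\rangle\simeq\mathbb{U}\simeq C_2/\langle 1_{C_2}\rangle$ (as cyclically ordered groups). The following conditions are equivalent. (1) $C_1$ and $C_2$ are isomorphic (as cyclically ordered groups). (2) $C_1$ and $C_2$ satisfy the same formulas $D_{p^n,k}$ ($p$ prime, $n\in\mathbb{N}^*$, $k\in\{0,\dots,p^n-1\}$). (3) $C_1\equiv C_2$ (in the language of cyclically ordered groups). (4) The characteristic sequence of $C_1$ is equal to the characteristic sequence of $C_2$.
   Context: All groups are abelian, written additively except subgroups of $\mathbb{K}$; $\mathbb{N}^*$ is the set of positive integers. A cyclically ordered group $(G,R)$ is an abelian group $G$ with a ternary relation $R$ such that: $R(a,b,c)$ implies that $a,b,c$ are pairwise distinct; $R(a,b,c)\Rightarrow R(b,c,a)$; for every $c\in G$, $R(c,\cdot,\cdot)$ is a strict linear order on $G\setminus\{c\}$; $R(a,b,c)\Rightarrow R(a+u,b+u,c+u)$. The language of cyclically ordered groups is the language of groups together with $R$. $G$ is discrete if it is trivial or $G\setminus\{0\}$ has a smallest element for the order $R(0,\cdot,\cdot)$; in the nontrivial case this smallest element is denoted $1_G$ (it is definable). $\mathbb{K}$ is the group of complex numbers of modulus $1$, cyclically ordered by: for $0\le\theta_1,\theta_2,\theta_3<2\pi$, $R(e^{i\theta_1},e^{i\theta_2},e^{i\theta_3})$ iff $\theta_1<\theta_2<\theta_3$ up to cyclic permutation of the indices; $\mathbb{U}\subset\mathbb{K}$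 is the subgroup of all roots of unity in $\mathbb{C}$. $G$ is c-archimedean if it is isomorphic, as a cyclically ordered group, to a subgroup of $\mathbb{K}$. If $G$ is discrete and not c-archimedean, $\langle 1_G\rangle\simeq\mathbb{Z}$ is a (c-)convex subgroup of $G$ and $G/\langle 1_G\rangle$ is cyclically ordered by: for $a,b,c$ in pairwise distinct classes, $R(\bar a,\bar b,\bar c)$ iff $R(a,b,c)$. A cyclically ordered group is c-divisible if it is divisible and contains a subgroup isomorphic to $\mathbb{U}$. $R(x_1,\dots,x_m)$ (with $m\ge3$) means that $R(x_i,x_j,x_k)$ holds for all $1\le i<j<k\le m$; $R(x_1,x_2)$ means $x_1\ne x_2$. For $G$ discrete and not c-archimedean, $p$ prime, $n\in\mathbb{N}^*$ and $k\in\{0,\dots,p^n-1\}$, $D_{p^n,k}$ is the formula $$\exists x,\; R(0,x,2x,\dots,(p^n-1)x)\wedge p^nx=k1_G.$$ If $G$ is discrete, not c-archimedean and $G/\langle1_G\rangle$ is c-divisible, then there is a unique sequence $(\varphi_p)_{p\text{ prime}}$ of maps $\varphi_p:\mathbb{N}^*\to\{0,\dots,p-1\}$ such that for all $p$, $n$, $k$: $D_{p^n,k}$ holds in $G$ iff $k=\varphi_p(1)+\varphi_p(2)p+\cdots+\varphi_p(n)p^{n-1}$. It is called the characteristic sequence of $G$. *)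

(* Defs.v *)
From HB Require Import structures.
From mathcomp Require Import all_boot all_order all_algebra.
From mathcomp Require Import boolp classical_sets reals trigo.
From mathcomp Require Import complex.

Set Implicit Arguments.
Unset Strict Implicit.
Unset Printing Implicit Defensive.

Import Order.TTheory GRing.Theory Num.Theory.
Local Open Scope ring_scope.

(* Structures for the language of cyclically ordered groups: an abelian group
   with an arbitrary ternary relation.  The axioms on the relation are in
   [cyclically_ordered], so that quotients and subgroups of the circle can be
   formed without a side condition. *)
Record cgroup := CGroup {
  cgroup_sort :> zmodType;
  cyc : cgroup_sort -> cgroup_sort -> cgroup_sort -> Prop
}.
Arguments cyc {c}.

Definition strict_linear_order_on (T : Type) (D : T -> Prop)
    (lt : T -> T -> Prop) : Prop :=
  [/\ forall x, D x -> ~ lt x x,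
      forall x y z, D x -> D y -> D z -> lt x y -> lt y z -> lt x z
    & forall x y, D x -> D y -> x <> y -> lt x y \/ lt y x].

Record cyclically_ordered (G : cgroup) : Prop := CyclicallyOrdered {
  cyc_distinct : forall a b c : G, cyc a b c -> [/\ a <> b, b <> c & a <> c];
  cyc_rot : forall a b c : G, cyc a b c -> cyc b c a;
  cyc_linear : forall c : G, strict_linear_order_on (fun x => x <> c) (cyc c);
  cyc_translate : forall a b c u : G,
    cyc a b c -> cyc (a + u) (b + u) (c + u)
}.

Definition cgroup_iso (G H : cgroup) : Prop :=
  exists f : {additive G -> H},
    bijective f /\ forall a b c : G, cyc a b c <-> cyc (f a) (f b) (f c).

Definition least_nonzero (G : cgroup) (u : G) : Prop :=
  u <> 0 /\ forall x : G, x <> 0 -> x <> u -> cyc 0 u x.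

Definition discrete (G : cgroup) : Prop :=
  (forall x : G, x = 0) \/ exists u : G, least_nonzero u.

(* The element 1_G; the value 0 is only taken when there is no least element. *)
Definition unit_elt (G : cgroup) : G := xget 0 [set u : G | least_nonzero u].

Section CycleQuotient.
Variable G : cgroup.

Definition cycle1 : {pred G} :=
  fun x => `[< exists n : int, x = unit_elt G *~ n >].

Lemma cycle1_zmod_closed : zmod_closed cycle1.
Proof.
split=> [|x y]; first by apply/asboolP; exists 0; rewrite mulr0z.
move=> /asboolP[m ->] /asboolP[n ->]; apply/asboolP.
by exists (m - n); rewrite mulrzBr.
Qed.

HB.instance Definition _ :=
  GRing.isZmodClosed.Build G cycle1 cycle1_zmod_closed.

Definition quot1_type : zmodType := Quotient.quot cycle1.

Definition class1 (x : G) : quot1_type := (\pi_(Quotient.quot cycle1) x)%qT.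

Definition quot1_cyc (A B C : quot1_type) : Prop :=
  [/\ A <> B, B <> C, A <> C
    & exists a b c : G,
        [/\ class1 a = A, class1 b = B, class1 c = C & cyc a b c]].

End CycleQuotient.

(* G / <1_G> *)
Definition quot1 (G : cgroup) : cgroup := CGroup (@quot1_cyc G).

(* The circle group, written additively: [x + y] is the product of complex
   numbers, so that [x *+ n] is the n-th power. *)
Section Circle.
Variable R : realType.
Local Open Scope complex_scope.

Record circle := Circle { circle_val : R[i]; circle_norm : `|circle_val| == 1 }.

HB.instance Definition _ := [isSub for circle_val].
HB.instance Definition _ := [Choice of circle by <:].

Lemma circle_mul_norm (x y : circle) :
  `|circle_val x * circle_val y| == 1.
Proof. by rewrite normrM (eqP (circle_norm x)) (eqP (circle_norm y)) mulr1. Qed.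

Lemma circle_inv_norm (x : circle) : `|(circle_val x)^-1| == 1.
Proof. by rewrite normfV (eqP (circle_norm x)) invr1. Qed.

Lemma circle_one_norm : `|1 : R[i]| == 1.
Proof. by rewrite normr1. Qed.

Definition circle_add x y := Circle (circle_mul_norm x y).
Definition circle_opp x := Circle (circle_inv_norm x).
Definition circle_zero := Circle circle_one_norm.

Lemma circle_addA : associative circle_add.
Proof. by move=> x y z; apply: val_inj; rewrite /= mulrA. Qed.

Lemma circle_addC : commutative circle_add.
Proof. by move=> x y; apply: val_inj; rewrite /= mulrC. Qed.

Lemma circle_add0 : left_id circle_zero circle_add.
Proof. by move=> x; apply: val_inj; rewrite /= mul1r. Qed.

Lemma circle_addN : left_inverse circle_zero circle_opp circle_add.
Proof.
move=> x; apply: val_inj; rewrite /= mulVf // -normr_eq0.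
by rewrite (eqP (circle_norm x)) oner_eq0.
Qed.

HB.instance Definition _ := GRing.isZmodule.Build circle
  circle_addA circle_addC circle_add0 circle_addN.

Definition expi (t : R) : R[i] := cos t +i* sin t.

Definition circle_cyc (x y z : circle) : Prop :=
  exists t1 t2 t3 : R,
    [/\ [/\ 0 <= t1 < 2 * pi, 0 <= t2 < 2 * pi & 0 <= t3 < 2 * pi],
        [/\ circle_val x = expi t1, circle_val y = expi t2
          & circle_val z = expi t3]
      & [\/ t1 < t2 /\ t2 < t3, t2 < t3 /\ t3 < t1 | t3 < t1 /\ t1 < t2]].

Definition unity_pred : {pred circle} :=
  fun x => `[< exists2 n : nat, (0 < n)%N & circle_val x ^+ n = 1 >].

Lemma unity_zmod_closed : zmod_closed unity_pred.
Proof.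
split=> [|x y]; first by apply/asboolP; exists 1%N => //; rewrite expr1.
move=> /asboolP[m m0 xm] /asboolP[n n0 yn]; apply/asboolP.
exists (m * n)%N; first by rewrite muln_gt0 m0.
by rewrite /= exprMn exprVn exprM xm expr1n mulnC exprM yn expr1n invr1 mulr1.
Qed.

HB.instance Definition _ :=
  GRing.isZmodClosed.Build circle unity_pred unity_zmod_closed.

Record unity := Unity { unity_val : circle; _ : unity_val \in unity_pred }.

HB.instance Definition _ := [isSub for unity_val].
HB.instance Definition _ := [Choice of unity by <:].
HB.instance Definition _ := [SubChoice_isSubZmodule of unity by <:].

Definition unity_cyc (x y z : unity) : Prop :=
  circle_cyc (unity_val x) (unity_val y) (unity_val z).

End Circle.

Definition KK (R : realType) : cgroup := CGroup (@circle_cyc R).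
Definition UU (R : realType) : cgroup := CGroup (@unity_cyc R).

(* An isomorphism onto a subgroup of KK is an injective morphism to KK that
   preserves and reflects the cyclic order. *)
Definition c_archimedean (R : realType) (G : cgroup) : Prop :=
  exists f : {additive G -> KK R},
    injective f /\ forall a b c : G, cyc a b c <-> cyc (f a) (f b) (f c).

(* R(x_1, ..., x_m), for m >= 2 *)
Definition cyc_seq (G : cgroup) (s : seq G) : Prop :=
  match s with
  | [:: x; y] => x <> y
  | _ => forall i j k : nat, (i < j)%N -> (j < k)%N -> (k < size s)%N ->
           cyc s`_i s`_j s`_k
  end.

(* D_{p^n,k} holds in G *)
Definition Dformula (G : cgroup) (p n k : nat) : Prop :=
  exists x : G,
    cyc_seq (mkseq (fun i => x *+ i) (p ^ n)) /\ x *+ (p ^ n) = unit_elt G *+ k.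

(* [phi p] is only relevant for p prime, and on positive integers. *)
Definition characteristic_sequence (G : cgroup) (phi : nat -> nat -> nat)
    : Prop :=
  forall p, prime p ->
    (forall n, (0 < n)%N -> (phi p n < p)%N) /\
    forall n k, (0 < n)%N -> (k < p ^ n)%N ->
      Dformula G p n k <-> k = (\sum_(1 <= i < n.+1) phi p i * p ^ i.-1)%N.

(* First-order formulas over the language (0, -, +, R) whose free variables are
   indexed by 'I_n; the quantifiers bind the variable of index 0. *)
Inductive cterm (n : nat) : Type :=
  | TVar of 'I_n
  | TZero
  | TOpp of cterm n
  | TAdd of cterm n & cterm n.

Inductive cformula : nat -> Type :=
  | FEq n of cterm n & cterm n : cformula n
  | FCyc n of cterm n & cterm n & cterm n : cformula n
  | FNot n of cformula n : cformula n
  | FAnd n of cformula n & cformula n : cformula n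
  | FOr n of cformula n & cformula n : cformula n
  | FImp n of cformula n & cformula n : cformula n
  | FAll n of cformula n.+1 : cformula n
  | FEx n of cformula n.+1 : cformula n.

Section Satisfaction.
Variable G : cgroup.

Definition env_cons n (x : G) (e : 'I_n -> G) : 'I_n.+1 -> G :=
  fun i => if unlift ord0 i is Some j then e j else x.

Fixpoint teval n (e : 'I_n -> G) (t : cterm n) : G :=
  match t with
  | TVar i => e i
  | TZero => 0
  | TOpp t1 => - teval e t1
  | TAdd t1 t2 => teval e t1 + teval e t2
  end.

Fixpoint fsat n (F : cformula n) : ('I_n -> G) -> Prop :=
  match F with
  | FEq _ t1 t2 => fun e => teval e t1 = teval e t2
  | FCyc _ t1 t2 t3 => fun e => cyc (teval e t1) (teval e t2) (teval e t3)
  | FNot _ F1 => fun e => ~ fsat F1 e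
  | FAnd _ F1 F2 => fun e => fsat F1 e /\ fsat F2 e
  | FOr _ F1 F2 => fun e => fsat F1 e \/ fsat F2 e
  | FImp _ F1 F2 => fun e => fsat F1 e -> fsat F2 e
  | FAll _ F1 => fun e => forall x : G, fsat F1 (env_cons x e)
  | FEx _ F1 => fun e => exists x : G, fsat F1 (env_cons x e)
  end.

(* A sentence is a formula without free variables. *)
Definition models (F : cformula 0) : Prop := fsat F (fun _ => 0).

End Satisfaction.

Definition elementarily_equivalent (G H : cgroup) : Prop :=
  forall F : cformula 0, models G F <-> models H F.

Section Wellposedness.

Lemma least_nonzero_unique (G : cgroup) (u v : G) : cyclically_ordered G ->
  least_nonzero u -> least_nonzero v -> u = v.
Proof.
move=> [d r l t] [u0 hu] [v0 hv]; apply: contrapT => uv.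
have [irr tr _] := l 0.
have uv1 := hu _ v0 (nesym uv).
have vu1 := hv _ u0 uv.
exact: irr u0 (tr _ _ _ u0 v0 u0 uv1 vu1).
Qed.

Lemma unit_eltP (G : cgroup) (u : G) :
  least_nonzero u -> least_nonzero (unit_elt G).
Proof. by move=> hu; apply: (@xgetPex _ _ [set u : G | least_nonzero u]); exists u. Qed.

Lemma class1E (G : cgroup) (a b : G) :
  class1 a = class1 b <-> exists n : int, a = b + unit_elt G *~ n.
Proof.
rewrite /class1; split.
  move=> /eqP; rewrite -Quotient.idealrBE => /asboolP[n hn].
  by exists n; rewrite -hn addrC subrK.
move=> [n ->]; apply/eqP; rewrite -Quotient.idealrBE; apply/asboolP.
by exists n; rewrite addrC addKr.
Qed.

(* The order on the quotient does not depend on the representatives. *)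
Lemma quot1_cycE (G : cgroup) (a b c : G) : cyclically_ordered G ->
  (exists u : G, least_nonzero u) ->
  class1 a <> class1 b -> class1 b <> class1 c -> class1 a <> class1 c ->
  quot1_cyc (class1 a) (class1 b) (class1 c) <-> cyc a b c.
Proof.
move=> [d r l t] [u0 /unit_eltP]; set u := unit_elt G => -[un0 hu].
pose D (x y : G) := class1 x <> class1 y.
have Dsym x y : D x y -> D y x by move=> xy; apply: nesym.
have classD (x : G) (n : int) : class1 (x + u *~ n) = class1 x.
  by apply/class1E; exists n.
have Dl x y n : D x y -> D (x + u *~ n) y by rewrite /D classD.
have Dn x y : D x y -> x <> y by move=> xy e; apply: xy; rewrite e.
have D1 x y : D x y -> D (x + u) y by move=> /(Dl _ _ 1); rewrite mulr1z.
have step x y : D x y -> cyc x (x + u) y.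
  move=> xy.
  have y0 : y - x <> 0.
    by move=> /eqP; rewrite subr_eq0 => /eqP /esym; apply: Dn.
  have yu : y - x <> u.
    by move=> e; apply: (Dn _ _ (D1 _ _ xy)); rewrite -e addrC subrK.
  by have := t _ _ _ x (hu _ y0 yu); rewrite add0r subrK addrC.
have fwd x y z : D x y -> D x z -> D y z -> cyc x y z -> cyc (x + u) y z.
  move=> xy xz yz xyz; have [_ tr _] := l y.
  have h1 := r _ _ _ (r _ _ _ (step x y xy)).
  have h2 := r _ _ _ xyz.
  apply: (r _ _ _ (r _ _ _ _)); apply: tr h2 h1.
  - exact: Dn (Dsym _ _ yz).
  - exact: Dn xy.
  - exact: Dn (D1 _ _ xy).
have bwd x y z : D x y -> D x z -> D y z -> cyc (x + u) y z -> cyc x y z.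
  move=> xy xz yz xyz; have [_ _ tot] := l x.
  have [//|xzy] := tot y z (nesym (Dn _ _ xy)) (nesym (Dn _ _ xz)) (Dn _ _ yz).
  have xuzy := fwd _ _ _ xz xy (Dsym _ _ yz) xzy.
  have [irr tr _] := l (x + u).
  have ny := nesym (Dn _ _ (D1 _ _ xy)); have nz := nesym (Dn _ _ (D1 _ _ xz)).
  by case: (irr y ny); exact: tr xyz xuzy.
have shiftn x y z (n : nat) : D x y -> D x z -> D y z ->
    cyc (x + u *+ n) y z <-> cyc x y z.
  move=> xy xz yz; elim: n => [|n IH]; first by rewrite mulr0n addr0.
  have xyn := Dl _ _ n%:Z xy; have xzn := Dl _ _ n%:Z xz.
  rewrite -IH mulrSr addrA; split; [exact: bwd | exact: fwd].
have shift x y z (n : int) : D x y -> D x z -> D y z ->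
    cyc (x + u *~ n) y z <-> cyc x y z.
  move=> xy xz yz; case: n => n; first exact: shiftn.
  have xyn := Dl _ _ (Negz n) xy; have xzn := Dl _ _ (Negz n) xz.
  rewrite -(shiftn _ _ _ n.+1 xyn xzn yz).
  by rewrite NegzE mulrNz subrK.
move=> ab bc ac; split=> [|abc]; last first.
  by split=> //; exists a, b, c.
move=> [_ _ _ [a' [b' [c' [/class1E[i ->] /class1E[j ->] /class1E[k ->]]]]]].
have rotE (x y z : G) : cyc x y z <-> cyc y z x.
  by split=> [/r|/r/r].
rewrite -/u shift; first last.
- by rewrite /D !classD.
- by rewrite /D classD.
- by rewrite /D classD.
rewrite rotE shift; first last.
- by rewrite /D classD; exact: Dsym.
- exact: Dsym.
- by rewrite /D classD.
rewrite rotE shift; first last.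
- exact: ab.
- exact: Dsym.
- exact: Dsym.
by rewrite rotE.
Qed.

Lemma characteristic_sequence_unique (G : cgroup) (phi psi : nat -> nat -> nat) :
  characteristic_sequence G phi -> characteristic_sequence G psi ->
  forall p n, prime p -> (0 < n)%N -> phi p n = psi p n.
Proof.
move=> hphi hpsi p n pp n0.
have [phi1 phi2] := hphi p pp; have [psi1 psi2] := hpsi p pp.
pose S (f : nat -> nat -> nat) n := (\sum_(1 <= i < n.+1) f p i * p ^ i.-1)%N.
have SS f m : S f m.+1 = (S f m + f p m.+1 * p ^ m)%N.
  by rewrite /S big_nat_recr.
have bound f m : (forall n, (0 < n)%N -> (f p n < p)%N) -> (S f m < p ^ m)%N.
  move=> hf; elim: m => [|m IH]; first by rewrite /S big_geq.
  rewrite SS; apply: (@leq_trans (p ^ m + f p m.+1 * p ^ m)).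
    by rewrite ltn_add2r.
  by rewrite -mulSn expnS leq_mul2r hf ?orbT.
have E m : S phi m = S psi m.
  case: m => [|m]; first by rewrite /S !big_geq.
  apply/(psi2 m.+1 _ isT (bound _ _ phi1)).
  exact/(phi2 m.+1 _ isT (bound _ _ phi1)).
case: n n0 => // n _.
have := E n.+1; rewrite !SS E => /addnI /eqP.
by rewrite eqn_pmul2r ?expn_gt0 ?prime_gt0 // => /eqP.
Qed.

End Wellposedness.

(* Main.v *)
Require Import Defs.
From HB Require Import structures.
From mathcomp Require Import all_boot all_order all_algebra.
From mathcomp Require Import boolp reals trigo complex.
From mathcomp Require Import zify ring lra.

(* Let [f : C -> U] be a surjection with kernel [<u>], u = 1_C; then [u] has
   infinite order. For each N > 0 lift [zeta N = e^(2 i pi / N)] to some [g];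
   then [N g = k u], and [k] modulo N, the residue of C at N, does not depend
   on the lift. An element [x] such that [0, x, ..., (N-1) x] are cyclically
   ordered and [N x = k u] must be a lift of [zeta N], so [D_{N,k}] says that
   [k] is the residue at N. The residues at multiples of N are compatible,
   hence the residues at the p^n give the characteristic sequence and, by the
   Chinese remainder theorem, determine the residue at every N.
   If C1 and C2 have the same residues, lifts [g], [g'] of [zeta N] can be
   chosen with [N g = k u] and [N g' = k u'] for the same [k]; then [a g + b
   u |-> a g' + b u'] (for all N, a, b) is an isomorphism of groups over U
   that sends [u] to [u'], and such a map preserves the cyclic order, because
   that order is determined by [f] and [u].
   Finally, D_{p^n,k} is expressed by a sentence, so that elementarily
   equivalent groups satisfy the same formulas D_{p^n,k}. *)

Set Implicit Arguments.
Unset Strict Implicit.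
Unset Printing Implicit Defensive.

Import Order.TTheory GRing.Theory Num.Theory.
Local Open Scope ring_scope.

(** * Roots of unity *)

Section RootsOfUnity.
Variable R : realType.
Local Open Scope complex_scope.

Lemma expiD (s t : R) : expi (s + t) = expi s * expi t.
Proof. by rewrite /expi cosD sinD; congr (_ +i* _); ring. Qed.

Lemma expiMn (t : R) n : expi (t *+ n) = expi t ^+ n.
Proof.
elim: n => [|n IH]; first by rewrite mulr0n expr0 /expi cos0 sin0.
by rewrite mulrS exprS expiD IH.
Qed.

Lemma expi_norm (t : R) : `|expi t| == 1.
Proof. by rewrite normc_def /= cos2Dsin2 sqrtr1; apply/eqP. Qed.

Lemma expi_2pi : expi (pi *+ 2 : R) = 1.
Proof.
have e : expi (pi : R) = -1.
  by apply/eqP; rewrite eq_complex /= cospi sinpi oppr0 !eqxx.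
by rewrite expiMn e sqrrN expr1n.
Qed.

(** Since [cos t = 1 - 2 sin^2 (t / 2)] and [t / 2] lies strictly between 0 and pi, the real part is
    below 1. *)
Lemma expi_neq1 (t : R) : 0 < t < 2 * pi -> expi t <> 1.
Proof.
move=> /andP[t0 tpi] /eqP; rewrite eq_complex /= => /andP[/eqP ct _].
have s0 : 0 < sin (t / 2) by apply: sin_gt0_pi; apply/andP; split; lra.
have: cos (t / 2 *+ 2) = 1 by rewrite -mulr_natr divfK ?pnatr_eq0.
rewrite cos_mulr2n; have := cos2Dsin2 (t / 2).
have : 0 < sin (t / 2) ^+ 2 by rewrite exprn_gt0.
by rewrite mulr2n; lra.
Qed.

Definition angle (N : nat) : R := 2 * pi / N%:R.

Lemma angleM_lt N a : (a < N)%N -> 0 <= angle N *+ a < 2 * pi.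
Proof.
move=> aN; have pi0 := pi_gt0 R.
have N0 : 0 < N%:R :> R by rewrite ltr0n (leq_ltn_trans _ aN).
rewrite -[_ *+ a]mulr_natr /angle; apply/andP; split.
  by rewrite mulr_ge0 ?ler0n // divr_ge0 ?ler0n // mulr_ge0 ?ltW.
by rewrite mulrAC ltr_pdivrMr // ltr_pM2l ?mulr_gt0 // ltr_nat.
Qed.

Lemma expi_angle N : (0 < N)%N -> expi (angle N) ^+ N = 1.
Proof.
move=> N0; rewrite -expiMn -[RHS]expi_2pi /angle -[_ *+ N]mulr_natr.
by rewrite divfK ?pnatr_eq0 -?lt0n // mulr_natl.
Qed.

Lemma expi_angle_prim N : (0 < N)%N -> N.-primitive_root (expi (angle N)).
Proof.
move=> N0; rewrite /primitive_root_of_unity N0 /=.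
apply/forallP => i; rewrite unity_rootE; apply/eqP.
have [->|iN] := eqVneq i.+1 N; first by rewrite expi_angle // eqxx.
apply/eqP; rewrite -expiMn; apply: expi_neq1.
have lt : (i.+1 < N)%N by rewrite ltn_neqAle iN ltn_ord.
have /andP[_ ->] := angleM_lt lt; rewrite andbT pmulrn_lgt0 //.
by rewrite /angle !mulr_gt0 ?invr_gt0 ?ltr0n ?pi_gt0.
Qed.

Definition zeta_circle N : circle R := Circle (expi_norm (angle N)).

Lemma circle_valMn (x : circle R) n : circle_val (x *+ n) = circle_val x ^+ n.
Proof.
elim: n => [|n IH]; first by rewrite mulr0n expr0.
by rewrite mulrS exprS -IH.
Qed.

Lemma zeta_unity N : zeta_circle N \in unity_pred (R := R).
Proof.
apply/asboolP; have [->|N0] := posnP N.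
  exists 1%N => //; rewrite expr1 /= /angle invr0 mulr0 /expi.
  by rewrite cos0 sin0.
by exists N; rewrite ?expi_angle.
Qed.

Definition zeta N : UU R := Unity (zeta_unity N).

Lemma unity_valMn (x : unity R) n : unity_val (x *+ n) = unity_val x *+ n.
Proof. by elim: n => [//|n IH]; rewrite !mulrS -IH. Qed.

Lemma zetaMnE N n : circle_val (unity_val (zeta N *+ n)) = expi (angle N *+ n).
Proof. by rewrite unity_valMn circle_valMn expiMn. Qed.

Lemma unity_eq (x y : unity R) :
  circle_val (unity_val x) = circle_val (unity_val y) -> x = y.
Proof. by move=> e; apply: val_inj; apply: val_inj. Qed.

Lemma zetaM N M : (0 < M)%N -> zeta (M * N) *+ M = zeta N.
Proof.
move=> M0; apply: unity_eq; rewrite zetaMnE /=; congr expi.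
rewrite /angle -[_ *+ M]mulr_natr -mulrA natrM invfM [_^-1 * _ * _]mulrAC.
by rewrite mulVf ?mul1r // pnatr_eq0 -lt0n.
Qed.

Lemma zetaMn_eq0 N n : (0 < N)%N -> zeta N *+ n = 0 <-> (N %| n)%N.
Proof.
move=> N0; rewrite (prim_order_dvd (expi_angle_prim N0)); split.
  move=> e; rewrite -expiMn -zetaMnE e; exact/eqP.
by move=> /eqP e; apply: unity_eq; rewrite zetaMnE expiMn e.
Qed.

Lemma zeta_cyc N a b c : (a < b)%N -> (b < c)%N -> (c < N)%N ->
  cyc (zeta N *+ a) (zeta N *+ b) (zeta N *+ c).
Proof.
move=> ab bc cN; have bN := ltn_trans bc cN; have aN := ltn_trans ab bN.
exists (angle N *+ a), (angle N *+ b), (angle N *+ c); split.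
- by split; apply: angleM_lt.
- by rewrite !zetaMnE.
- have N0 : 0 < angle N.
    by rewrite /angle !mulr_gt0 ?invr_gt0 ?ltr0n ?pi_gt0 ?(leq_ltn_trans _ aN).
  by apply: Or31; rewrite !ltr_pMn2l // N0 ab bc.
Qed.

Lemma unity_zeta N (x : UU R) : (0 < N)%N -> x *+ N = 0 ->
  exists2 a, (a < N)%N & x = zeta N *+ a.
Proof.
move=> N0 xN; have xN1 : circle_val (unity_val x) ^+ N = 1.
  by rewrite -circle_valMn -unity_valMn xN.
have [a xa] := prim_rootP (expi_angle_prim N0) xN1.
by exists a => //; apply: unity_eq; rewrite zetaMnE expiMn.
Qed.

Lemma unity_torsion (x : UU R) : exists2 N, (0 < N)%N & x *+ N = 0.
Proof.
have /asboolP[N N0 xN] := valP x; exists N => //.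
by apply: unity_eq; rewrite unity_valMn circle_valMn.
Qed.

End RootsOfUnity.

(** * Cyclic orders and extensions of the roots of unity *)

Section CyclicOrder.
Variables (G : cgroup) (hG : cyclically_ordered G).

Lemma cyc_trans (d a b c : G) : cyc d a b -> cyc d b c -> cyc d a c.
Proof.
move=> dab dbc; have [_ tr _] := cyc_linear hG d.
have [da ab db] := cyc_distinct hG dab; have [_ _ dc] := cyc_distinct hG dbc.
by apply: tr dab dbc; apply: nesym.
Qed.

Lemma cyc_asym (a b c : G) : cyc a b c -> ~ cyc a c b.
Proof.
move=> abc acb; have := cyc_trans abc acb.
by move=> /(cyc_distinct hG)[_ /(_ erefl)].
Qed.

Lemma cyc_total (a b c : G) : a <> b -> b <> c -> a <> c ->
  cyc a b c \/ cyc a c b.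
Proof.
move=> ab bc ac; have [_ _ tot] := cyc_linear hG a.
by apply: tot => //; apply: nesym.
Qed.

(** Rotated so that [b] comes first, the hypotheses read [b, d, a] and [b, c, d] and compose by
    transitivity. *)
Lemma cyc_glue (d a b c : G) : cyc d a b -> cyc d b c -> cyc a b c.
Proof.
move=> /(cyc_rot hG)/(cyc_rot hG) bda /(cyc_rot hG) bcd.
exact: (cyc_rot hG (cyc_rot hG (cyc_trans bcd bda))).
Qed.

(** Totality at [d] gives eight cases. If at most one of [cyc d a b], [cyc d b c], [cyc d c a]
    holds, two of the reversed relations glue to the orientation [a, c, b], a contradiction. *)
Lemma cyc_cut (d a b c : G) : cyc a b c -> d <> a -> d <> b -> d <> c ->
  [\/ cyc d a b /\ cyc d b c, cyc d b c /\ cyc d c a | cyc d c a /\ cyc d a b].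
Proof.
move=> abc da db dc; have [ab bc ac] := cyc_distinct hG abc.
have bca := cyc_rot hG abc; have cab := cyc_rot hG bca.
have ca := nesym ac.
have [dab|dba] := cyc_total da ab db; have [dbc|dcb] := cyc_total db bc dc;
  have [dca|dac] := cyc_total dc ca da; try by [constructor 1 | constructor 2
  | constructor 3].
- by case: (cyc_asym abc); apply: cyc_glue dac dcb.
- by case: (cyc_asym bca); apply: cyc_glue dba dac.
- by case: (cyc_asym cab); apply: cyc_glue dcb dba.
- by case: (cyc_asym cab); apply: cyc_glue dcb dba.
Qed.

(** By induction: [u] precedes [x - n u], which is again outside the multiples of [u]; translating
    by [n u] puts [(n + 1) u] between [n u] and [x]. *)
Lemma cyc_unit_mul (u x : G) n : least_nonzero u ->
  (forall m : int, x <> u *~ m) -> cyc 0 (u *+ n.+1) x.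
Proof.
move=> [u0 hu] xu; elim: n => [|n IH].
  by apply: hu; [apply: xu 0 | apply: xu 1].
have y0 : x - u *+ n.+1 <> 0.
  by move=> /eqP; rewrite subr_eq0 => /eqP; apply: xu n.+1%:Z.
have yu : x - u *+ n.+1 <> u.
  move=> /eqP; rewrite subr_eq -mulrS => /eqP; exact: xu n.+2%:Z.
have := cyc_translate hG (u *+ n.+1) (hu _ y0 yu).
rewrite add0r subrK -mulrS => /(cyc_rot hG)/(cyc_rot hG) xun.
have /(cyc_rot hG)/(cyc_rot hG) x0n := IH.
exact: (cyc_rot hG (cyc_trans x0n xun)).
Qed.

End CyclicOrder.

(** What is kept of the isomorphism from [quot1 G] to U. [ext_ord] speaks only of triples in
    distinct fibers; the order inside a fiber is recovered from [u]. *)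
Record unity_extension (R : realType) (G : cgroup) (u : G)
    (f : {additive G -> UU R}) : Prop := UnityExtension {
  ext_cyc : cyclically_ordered G;
  ext_least : least_nonzero u;
  ext_ker : forall x, f x = 0 <-> exists n : int, x = u *~ n;
  ext_surj : forall z, exists x, f x = z;
  ext_ord : forall a b c, f a <> f b -> f b <> f c -> f a <> f c ->
    cyc (f a) (f b) (f c) <-> cyc a b c
}.

Lemma zeta2_neq0 (R : realType) : zeta R 2 <> 0.
Proof. by rewrite -[zeta R 2]mulr1n => /(zetaMn_eq0 R _ (ltn0Sn 1)). Qed.

Lemma extension_exists (R : realType) (G : cgroup) : cyclically_ordered G ->
  discrete G -> cgroup_iso (quot1 G) (UU R) ->
  exists f : {additive G -> UU R}, unity_extension (unit_elt G) f.
Proof.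
move=> hG dG [h [[h' hK h'K] hcyc]].
have surj z : exists x, h (class1 x) = z.
  by exists (repr (h' z)); rewrite /class1 reprK h'K.
(* The trivial group is ruled out: its quotient cannot map onto U, which contains [zeta R 2], that
   is, -1. *)
have leastG : exists u : G, least_nonzero u.
  case: dG => // triv; have [x hx] := surj (zeta R 2).
  case: (@zeta2_neq0 R); rewrite -hx (triv x) -[RHS](raddf0 h).
  by congr (h _); rewrite /class1 raddf0.
have [u lu] := leastG.
pose q : {additive G -> quot1 G} := (\pi_(Quotient.quot (@cycle1 G)))%qT.
exists (h \o q : {additive _ -> _}); split => //.
- exact: unit_eltP lu.
- move=> x; have H : (h \o q) x = 0 <-> class1 x = class1 (0 : G).
    have e0 : class1 (0 : G) = 0 by rewrite /class1 raddf0.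
    rewrite e0 /= -/(class1 x); split=> [|->]; last exact: raddf0.
    by rewrite -[RHS](raddf0 h) => /(can_inj hK).
  by rewrite H class1E; split=> -[n ->]; exists n; rewrite ?add0r.
- by move=> a b c ab bc ac; rewrite -hcyc /=; apply: quot1_cycE => // e;
    [apply: ab | apply: bc | apply: ac]; rewrite /= /q /= -/(class1 _) e.
Qed.

Section Extension.
Variables (R : realType) (G : cgroup) (u : G) (f : {additive G -> UU R}).
Hypothesis E : unity_extension u f.

Lemma ext_unit n : f (u *~ n) = 0.
Proof. by apply/(ext_ker E); exists n. Qed.

(** An [x] over -1 lies outside the multiples of [u], so each [(m + 1) u] is strictly between 0 and
    [x], hence nonzero. *)
Lemma ext_unit_inj (n : int) : u *~ n = 0 -> n = 0.
Proof.
have [x xf] := ext_surj E (zeta R 2).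
have xu (m : int) : x <> u *~ m.
  by move=> e; apply: (@zeta2_neq0 R); rewrite -xf e ext_unit.
have pos m : u *+ m.+1 <> 0.
  have := cyc_unit_mul (ext_cyc E) m (ext_least E) xu.
  by move=> /(cyc_distinct (ext_cyc E))[/nesym].
case: n => [[|m]|m] //; first by move=> /pos.
by rewrite NegzE mulrNz => /eqP; rewrite oppr_eq0 => /eqP/pos.
Qed.

Lemma ext_fiber x y : f x = f y -> exists n : int, y = x + u *~ n.
Proof.
move=> e; have /(ext_ker E)[n en] : f (y - x) = 0 by rewrite raddfB e subrr.
by exists n; rewrite -en addrC subrK.
Qed.

(** Seen from a point of another fiber, the fiber of [a] is ordered like the integers. For [n < 0]
    the positive case based at [a + n u] gives the reversed relation. *)
Lemma ext_cyc_fiber a x (n : int) : f x <> f a ->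
  cyc a (a + u *~ n) x <-> 0 < n.
Proof.
have hG := ext_cyc E.
have pos b y (m : nat) : f y <> f b -> cyc b (b + u *+ m.+1) y.
  move=> yb; have yu k : y - b <> u *~ k.
    move=> e; apply: yb; have : f (y - b) = 0 by rewrite e ext_unit.
    by rewrite raddfB => /eqP; rewrite subr_eq0 => /eqP.
  have := cyc_translate hG b (cyc_unit_mul hG m (ext_least E) yu).
  by rewrite add0r subrK addrC.
move=> xa; split; last by case: n => [[|m]|m] // _; apply: pos.
case: n => [[|m]|m] //; first by rewrite mulr0z addr0 => /(cyc_distinct hG)[].
have xa' : f x <> f (a + u *~ Negz m) by rewrite raddfD ext_unit addr0.
have := pos _ _ m xa'; rewrite NegzE mulrNz subrK => /(cyc_rot hG).
by move=> /(cyc_rot hG) h /(cyc_rot hG)/(cyc_rot hG)/(cyc_asym hG)/(_ h).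
Qed.

Lemma ext_lift N : (0 < N)%N ->
  exists g k, [/\ f g = zeta R N, g *+ N = u *+ k & (k < N)%N].
Proof.
move=> N0; have [g gz] := ext_surj E (zeta R N).
have /(ext_ker E)[m gm] : f (g *+ N) = 0.
  by rewrite raddfMn gz; apply/zetaMn_eq0.
have N0' : N%:Z != 0 by rewrite eqz_nat -lt0n.
(* Subtracting [(m %/ N) u] from the lift brings [m] down to [m %% N]. *)
exists (g - u *~ (m %/ N)%Z), `|(m %% N)%Z|%N; split.
- by rewrite raddfB ext_unit subr0.
- rewrite mulrnBl gm !pmulrn gez0_abs ?modz_ge0 //.
  by rewrite -mulrzA -mulrzBr {1}(divz_eq m N) addrAC subrr add0r.
- by rewrite -ltz_nat gez0_abs ?modz_ge0 // ltz_pmod.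
Qed.

(** [g' *+ M] is a second lift of [zeta R N], so it is [g + m u]; multiplying by [N] and cancelling
    [u], of infinite order, compares [k'] with [k]. *)
Lemma ext_lift_mul N M g g' k k' : f g = zeta R N -> f g' = zeta R (M * N) ->
  (0 < M)%N -> g *+ N = u *+ k -> g' *+ (M * N) = u *+ k' ->
  exists m : int, g' *+ M = g + u *~ m /\ k'%:Z = k%:Z + m * N%:Z.
Proof.
move=> gz gz' M0 gN gN'.
have e : f g = f (g' *+ M) by rewrite raddfMn gz' zetaM.
have [m em] := ext_fiber e; exists m; split => //.
apply/eqP; rewrite -subr_eq0; apply/eqP/ext_unit_inj.
rewrite mulrzBr mulrzDr -!pmulrn -gN' mulrnA em mulrnDl gN.
by rewrite mulrzA -pmulrn subrr.
Qed.

End Extension.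

(** * Residues and isomorphisms *)

Section Residue.
Variables (R : realType) (G : cgroup) (u : G) (f : {additive G -> UU R}).
Hypothesis E : unity_extension u f.

(** Having exact order [N], [f x] generates the [N]-th roots of unity; the only generator whose
    multiples come in cyclic order is the first one after 0. *)
Lemma zeta_of_cyc_seq (x : G) N : (1 < N)%N -> f x *+ N = 0 ->
  (forall d, (0 < d < N)%N -> f x *+ d <> 0) ->
  cyc_seq (mkseq (fun i => x *+ i) N) -> f x = zeta R N.
Proof.
move=> N1 xN xd cx; have N0 := ltnW N1; have hG := ext_cyc E.
have [b bN xb] := unity_zeta N0 xN.
have b0 : (0 < b)%N.
  by rewrite lt0n; apply/eqP => b0; apply: (xd 1%N); rewrite // xb b0.
(* Otherwise [N %/ gcdn b N], smaller than [N], would already kill [f x]. *)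
have cop : coprime b N.
  rewrite /coprime; have d0 : (0 < gcdn b N)%N by rewrite gcdn_gt0 b0.
  apply: contraT => d1; have dN := dvdn_gcdr b N.
  case: (xd (N %/ gcdn b N)%N).
    rewrite divn_gt0 // dvdn_leq // ltn_Pdiv //.
    by rewrite ltn_neqAle eq_sym d1.
  rewrite xb -mulrnA; apply/zetaMn_eq0 => //.
  by rewrite muln_divA // -divn_mulAC ?dvdn_gcdl // dvdn_mull.
(* [j] is the inverse of [b] modulo [N]. *)
have [j jN jb] : exists2 j, (j < N)%N & f x *+ j = zeta R N.
  have /(coprimeP _ b0)[[c d] /= cd] := cop.
  exists (c %% N)%N; rewrite ?ltn_mod //.
  have e : (b * c)%N = (d * N + 1)%N by nia.
  have /(congr1 (fun n => n *+ c)) := xb; rewrite -mulrnA e.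
  rewrite mulrnDr mulr1n mulnC mulrnA (_ : zeta R N *+ N = 0); last first.
    exact/zetaMn_eq0.
  rewrite mul0rn add0r => <-; rewrite [in RHS](divn_eq c N) mulrnDr mulnC.
  by rewrite mulrnA xN mul0rn add0r.
(* If b > 1, then [zeta R N = f (x *+ j)] precedes [f x], although j > 1. *)
have [b1|b1] := eqVneq b 1%N; first by rewrite xb b1.
have zx (c d : nat) : (c < d)%N -> (d < N)%N -> zeta R N *+ c <> zeta R N *+ d.
  move=> cd dN e; have : zeta R N *+ (d - c) = 0.
    by rewrite mulrnBr ?(ltnW cd) // e subrr.
  by move=> /(zetaMn_eq0 R _ N0)/dvdn_leq; lia.
have b2 : (1 < b)%N by lia.
have j2 : (1 < j)%N.
  case: j jN jb => [|[|//]] jN.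
    by rewrite mulr0n; have := @zx 0%N 1%N isT N1; rewrite mulr0n mulr1n.
  by rewrite mulr1n xb; have := zx 1%N b b2 bN; rewrite mulr1n => h /esym.
have c1 : cyc 0 x (x *+ j).
  (* For [N = 2], [cyc_seq] only says that two elements differ; [1 < b < N] excludes this case. *)
  have Ns : (2 < N)%N by exact: leq_trans bN.
  have := cx; case: (N) Ns jN => [|[|[|N']]] // _ jN cx'.
  have := cx' 0%N 1%N j isT j2; rewrite size_mkseq => /(_ jN).
  by rewrite !nth_mkseq.
have z01 := zx 0%N 1%N isT N1; have z0b := zx 0%N b b0 bN.
have z1b := zx 1%N b b2 bN; rewrite mulr0n mulr1n in z01 z0b z1b.
have c2 : cyc 0 (x *+ j) x.
  apply/(ext_ord E); rewrite ?raddf0 ?raddfMn ?jb ?xb //.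
  have := @zeta_cyc R N 0 1 b isT b2 bN.
  by rewrite mulr0n mulr1n.
by case: (cyc_asym hG c1).
Qed.

Definition residue N k := exists g, f g = zeta R N /\ g *+ N = u *+ k.

End Residue.

Section Matching.
Variable R : realType.

Definition matched (G H : cgroup) (u : G) (f : {additive G -> UU R})
    (v : H) (h : {additive H -> UU R}) N x y :=
  exists k, [/\ f x = zeta R N, h y = zeta R N, x *+ N = u *+ k
    & y *+ N = v *+ k].

(** The graph of the future isomorphism, taken as a relation so that no coherent choice of lifts
    over all [N] has to be made. *)
Definition paired (G H : cgroup) (u : G) (f : {additive G -> UU R})
    (v : H) (h : {additive H -> UU R}) x y :=
  exists N g g' (a b : int), [/\ (0 < N)%N, matched u f v h N g g',
    x = g *~ a + u *~ b & y = g' *~ a + v *~ b].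

Lemma zetaMz_eq0 N (a : int) : (0 < N)%N -> zeta R N *~ a = 0 ->
  exists t : int, a = t * N%:Z.
Proof.
move=> N0 za; have : zeta R N *+ `|a|%N = 0.
  case: (intP a) za => [//|n //|n]; rewrite mulrNz abszN /= => /eqP.
  by rewrite oppr_eq0 => /eqP.
by move=> /(zetaMn_eq0 R _ N0) da; apply/dvdzP.
Qed.

(** Used to subtract combinations taken at levels [N] and [L] once both lifts are expressed by one
    lift [z] at level [L * N]; [w] stands for [u] or [v]. *)
Lemma lin_comb (V : zmodType) (z w : V) (L N : nat) (m n a b c d : int) :
  (z *+ L + w *~ m) *~ a + w *~ b - ((z *+ N + w *~ n) *~ c + w *~ d) =
  z *~ (L%:Z * a - N%:Z * c) + w *~ (m * a + b - n * c - d).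
Proof.
rewrite !pmulrn !mulrzDl !mulrzBr !mulrzDr !mulrzA !opprD -!addrA.
by congr (_ + _); rewrite [w *~ b + _]addrCA [RHS]addrCA; congr (_ + _).
Qed.

Section Pair.
Variables (G H : cgroup) (u : G) (f : {additive G -> UU R}).
Variables (v : H) (h : {additive H -> UU R}).
Hypothesis (E : unity_extension u f) (F : unity_extension v h).

Lemma matched_sym N x y : matched u f v h N x y -> matched v h u f N y x.
Proof. by move=> [k [? ? ? ?]]; exists k. Qed.

Lemma paired_sym x y : paired u f v h x y -> paired v h u f y x.
Proof.
move=> [N [g [g' [a [b [N0 gg' -> ->]]]]]].
by exists N, g', g, a, b; split=> //; apply: matched_sym.
Qed.

(** From [g *~ a + u *~ b = 0] follow [a = t N] and, [u] having infinite order, [t k + b = 0]. This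
    involves only the common residue [k], so it also kills the other side. With [paired_sub], it
    makes the relation single-valued. *)
Lemma paired0 y : paired u f v h 0 y -> y = 0.
Proof.
move=> [N [g [g' [a [b [N0 [k [gz gz' gN gN']] e ->]]]]]].
have za : zeta R N *~ a = 0.
  by rewrite -gz -raddfMz -[RHS](raddf0 f) e raddfD (ext_unit E) addr0.
have [t at_] := zetaMz_eq0 N0 za.
have tk : t * k%:Z + b = 0.
  apply: (ext_unit_inj E); rewrite mulrzDr e at_; congr (_ + _).
  by rewrite ![t * _]mulrC !mulrzA -!pmulrn gN.
by rewrite at_ [t * _]mulrC mulrzA -pmulrn gN' pmulrn -mulrzA [_ * t]mulrC
  -mulrzDr tk.
Qed.

(** Each side has a shift satisfying [l = k + m N]; since [k] and [l] are shared, the two shifts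
    agree. *)
Lemma matched_raise N M g g' x x' : (0 < N)%N -> (0 < M)%N ->
  matched u f v h N g g' -> matched u f v h (M * N) x x' ->
  exists m : int, g = x *+ M + u *~ m /\ g' = x' *+ M + v *~ m.
Proof.
move=> N0 M0 [k [gz gz' gN gN']] [l [xz xz' xN xN']].
have [m [em lm]] := ext_lift_mul E gz xz M0 gN xN.
have [m' [em' lm']] := ext_lift_mul F gz' xz' M0 gN' xN'.
have mm : m' = m.
  have N0' : N%:Z != 0 by rewrite eqz_nat -lt0n.
  by apply: (mulIf N0'); apply: (addrI k%:Z); rewrite -lm -lm'.
exists (- m); rewrite em em' mm !mulrNz.
by rewrite -!addrA !subrr !addr0.
Qed.

Hypothesis M : forall N, (0 < N)%N -> exists x y, matched u f v h N x y.

Lemma paired_total x : exists y, paired u f v h x y.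
Proof.
have [N N0 fN] := unity_torsion (f x).
have [a aN fx] := unity_zeta N0 fN.
have [g [g' gg']] := M N0; have [k [gz _ _ _]] := gg'.
have e : f (g *+ a) = f x by rewrite raddfMn gz.
have [b ->] := ext_fiber E e; exists (g' *~ a%:Z + v *~ b).
by exists N, g, g', a%:Z, b.
Qed.

Lemma paired_sub x x' y y' : paired u f v h x x' -> paired u f v h y y' ->
  paired u f v h (x - y) (x' - y').
Proof.
move=> [N [g [g' [a [b [N0 gg' -> ->]]]]]] [L [w [w' [c [d [L0 ww' -> ->]]]]]].
have LN0 : (0 < L * N)%N by rewrite muln_gt0 L0.
have [z [z' zz']] := M LN0.
have [m [-> ->]] := matched_raise N0 L0 gg' zz'.
rewrite mulnC in zz'; have [n [-> ->]] := matched_raise L0 N0 ww' zz'.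
exists (N * L)%N, z, z', (L%:Z * a - N%:Z * c), (m * a + b - n * c - d).
rewrite mulnC; split=> //; first by rewrite mulnC.
- exact: lin_comb.
- exact: lin_comb.
Qed.
End Pair.
End Matching.

Section Iso.
Variables (R : realType) (G H : cgroup) (u : G) (f : {additive G -> UU R}).
Variables (v : H) (h : {additive H -> UU R}).
Hypothesis (E : unity_extension u f) (F : unity_extension v h).

Section Order.
Variables (s : {additive G -> H}) (su : s u = v) (hs : forall x, h (s x) = f x).

(** If the three images under [f] are distinct, [ext_ord] transfers the relation; if exactly two
    agree, [ext_cyc_fiber] does, after a rotation; if all agree, the cycle is cut at a point [d] of
    another fiber, which reduces to the previous case. *)
Lemma morphism_cyc a b c : cyc a b c -> cyc (s a) (s b) (s c).
Proof.
have hG := ext_cyc E; have hH := ext_cyc F.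
have two x y z : f x = f y -> f z <> f x -> cyc x y z -> cyc (s x) (s y) (s z).
  move=> xy zx; have [n ->] := ext_fiber E xy.
  move=> /(ext_cyc_fiber E _ zx) n0.
  by rewrite raddfD raddfMz su; apply/(ext_cyc_fiber F) => //; rewrite !hs.
move=> abc; have bca := cyc_rot hG abc; have cab := cyc_rot hG bca.
have [ab|ab] := EM (f a = f b); last first.
  have [bc|bc] := EM (f b = f c).
    by apply: (cyc_rot hH); apply: (cyc_rot hH); apply: two; rewrite -?bc.
  have [ca|ca] := EM (f c = f a).
    by apply: (cyc_rot hH); apply: two => // ba; apply: ab; rewrite ba.
  have ac := nesym ca.
  by apply/(ext_ord F); rewrite ?hs //; apply/(ext_ord E).
have [bc|bc] := EM (f b = f c); last by apply: two => // /esym; rewrite ab.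
have [t ft] := ext_surj F (zeta R 2).
have [d fd] := ext_surj E (zeta R 2 + f a).
have da x : f x = f a -> f d <> f x.
  move=> -> e; apply: (@zeta2_neq0 R).
  by apply: (addIr (f a)); rewrite add0r -fd.
have D x : f x = f a -> d <> x by move=> /da xa e; apply: xa; rewrite e.
have at_d x y : f x = f a -> f y = f a -> cyc d x y -> cyc (s d) (s x) (s y).
  move=> xa ya dxy; apply: (cyc_rot hH); apply: (cyc_rot hH).
  by apply: two; [rewrite xa | exact: da | exact: (cyc_rot hG)].
have := cyc_cut hG abc (D _ erefl) (D _ (esym ab)) (D _ (esym (etrans ab bc))).
have fb := esym ab; have fc := esym (etrans ab bc).
case=> -[/at_d h1 /at_d h2].
- exact: (cyc_glue hH (h1 _ _) (h2 _ _)).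
- apply: (cyc_rot hH); apply: (cyc_rot hH).
  exact: (cyc_glue hH (h1 _ _) (h2 _ _)).
- by apply: (cyc_rot hH); exact: (cyc_glue hH (h1 _ _) (h2 _ _)).
Qed.

End Order.

Lemma matched_iso :
  (forall N, (0 < N)%N -> exists x y, matched u f v h N x y) ->
  cgroup_iso G H.
Proof.
move=> M; have hG := ext_cyc E; have hH := ext_cyc F.
have M' N : (0 < N)%N -> exists x y, matched v h u f N x y.
  by move=> /M[x [y /matched_sym xy]]; exists y, x.
have [s sP] := choice (paired_total E M).
have uniq x y y' : paired u f v h x y -> paired u f v h x y' -> y = y'.
  move=> xy xy'; have := paired_sub E F M xy xy'; rewrite subrr.
  by move/(paired0 E)/eqP; rewrite subr_eq0 => /eqP.
have s_add : zmod_morphism s.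
  by move=> x y; apply: uniq (sP _) (paired_sub E F M (sP x) (sP y)).
pose S : {additive G -> H} :=
  HB.pack s (GRing.isZmodMorphism.Build _ _ s s_add).
have Su : S u = v.
  (* At level [N = 1], [u] is [0 g + 1 u], hence paired with [v]. *)
  have [g [g' gg']] := M 1%N isT; apply: uniq (sP _) _.
  by exists 1%N, g, g', 0, 1; split; rewrite // mulr0z mulr1z add0r.
have hS x : h (S x) = f x.
  have [N [g [g' [a [b [_ [k [gz gz' _ _]] -> /= ->]]]]]] := sP x.
  by rewrite !raddfD !raddfMz gz gz' -!raddfMz (ext_unit E) (ext_unit F).
exists S; split.
  have [t tP] := choice (paired_total F M').
  have uniq' y x x' : paired u f v h x y -> paired u f v h x' y -> x = x'.
    move=> xy xy'; have := paired_sub E F M xy xy'; rewrite subrr.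
    by move/paired_sym/(paired0 F)/eqP; rewrite subr_eq0 => /eqP.
  exists t => x; first by apply: uniq' (paired_sym (tP _)) (sP _).
  by apply: uniq (sP _) (paired_sym (tP _)).
move=> a b c; split; first exact: morphism_cyc Su hS a b c.
(* If [cyc a b c] failed, totality would give [cyc a c b], which [S] preserves. *)
move=> sabc; have [ab bc ac] := cyc_distinct hH sabc.
have [//|acb] : cyc a b c \/ cyc a c b.
  by apply: cyc_total => // e; [apply: ab | apply: bc | apply: ac]; rewrite e.
by case: (cyc_asym hH sabc); apply: morphism_cyc Su hS _ _ _ acb.
Qed.

End Iso.

Section Residues.
Variables (R : realType) (G : cgroup) (u : G) (f : {additive G -> UU R}).
Hypothesis E : unity_extension u f.

Lemma residue_exists N : (0 < N)%N -> exists2 k, (k < N)%N & residue u f N k.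
Proof. by move=> /(ext_lift E)[g [k [? ? ?]]]; exists k => //; exists g. Qed.

Lemma residue_mod N M k l : (0 < M)%N -> residue u f N k ->
  residue u f (M * N) l -> l = k %[mod N].
Proof.
move=> M0 [g [gz gN]] [g' [gz' gN']].
have [m [_ lk]] := ext_lift_mul E gz gz' M0 gN gN'.
have: (l%:Z == k%:Z %[mod N])%Z.
  by rewrite eqz_mod_dvd lk addrAC subrr add0r dvdz_mull.
by rewrite !modz_nat eqz_nat => /eqP.
Qed.

Lemma residue_uniq N k l : (k < N)%N -> (l < N)%N -> residue u f N k ->
  residue u f N l -> k = l.
Proof.
move=> kN lN rk rl; rewrite -(mul1n N) in rk.
by have := residue_mod (ltn0Sn 0) rl rk; rewrite !modn_small.
Qed.

(** In one direction, no [x *+ d] with [0 < d < N] lies in the kernel, so [zeta_of_cyc_seq] applies;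
    in the other, the multiples of a lift lie in distinct fibers and inherit the order of the
    multiples of [zeta R N]. *)
Lemma multiples_residue N k : (1 < N)%N -> (k < N)%N ->
  (exists x, cyc_seq (mkseq (fun i => x *+ i) N) /\ x *+ N = u *+ k) <->
  residue u f N k.
Proof.
move=> N1 kN; have N0 := ltnW N1; have hG := ext_cyc E; split.
  move=> [x [cx xN]]; exists x; split=> //.
  have fxN : f x *+ N = 0 by rewrite -raddfMn xN pmulrn (ext_unit E).
  apply: (zeta_of_cyc_seq E) => // d /andP[d0 dN] fd.
  have /(ext_ker E)[j xd] : f (x *+ d) = 0 by rewrite raddfMn.
  (* Here 0 < j, so that [x *+ d] lies in the initial segment u, 2u, 3u, ...,
     before [x]. *)
  have jk : j * N%:Z = k%:Z * d%:Z.
    apply/eqP; rewrite -subr_eq0; apply/eqP; apply: (ext_unit_inj E).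
    by rewrite mulrzBr !mulrzA -!pmulrn -xN -xd -!mulrnA mulnC subrr.
  have xd0 : x *+ d <> 0.
    have := cx; case: (N) N1 dN => [|[|[|N']]] // _ dN'.
      have -> : d = 1%N by lia.
      by rewrite /= mulr0n => /nesym.
    have [d1|d1] := eqVneq d 1%N.
      move=> cx'; have := cx' 0%N 1%N 2%N isT isT.
      rewrite size_mkseq => /(_ isT).
      by rewrite d1 !nth_mkseq // => /(cyc_distinct hG)[/nesym].
    move=> cx'; have := cx' 0%N 1%N d isT _; rewrite size_mkseq => h.
    have {}h := h _ dN'; have := h ltac:(lia); rewrite !nth_mkseq //.
    by move=> /(cyc_distinct hG)[_ _ /nesym].
  have j0 : 0 < j.
    rewrite lt0r; apply/andP; split; last by nia.
    by apply/eqP => j0; apply: xd0; rewrite xd j0.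
  case: j j0 xd jk => [[|j]|j] // _ xd jk.
  have d1 : (1 < d)%N by nia.
  (* If [x = m u], then [m N = k < N] forces [m = 0], hence [x = 0], against [xd0]. *)
  have xu m : x <> u *~ m.
    move=> e; have : u *~ (m * N%:Z - k%:Z) = 0.
      by rewrite mulrzBr mulrzA -!pmulrn -xN -e subrr.
    move=> /(ext_unit_inj E) mk; have m0 : m = 0 by nia.
    have fx : f x = 0 by rewrite e m0 mulr0z raddf0.
    by move: xd0; rewrite (_ : x = 0) ?mul0rn // e m0.
  have c1 : cyc 0 x (x *+ d).
    have := cx; have : (2 < N)%N by lia.
    case: (N) dN => [|[|[|N']]] // dN' _ cx'.
    have := cx' 0%N 1%N d isT d1; rewrite size_mkseq => /(_ dN').
    by rewrite !nth_mkseq.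
  case: (cyc_asym hG c1); rewrite xd -pmulrn.
  exact: (cyc_unit_mul hG _ (ext_least E) xu).
move=> [g [gz gN]]; exists g; split=> //.
have fne a b : (a < b)%N -> (b < N)%N -> f (g *+ a) <> f (g *+ b).
  move=> ab bN; rewrite !raddfMn gz => e.
  have : zeta R N *+ (b - a) = 0 by rewrite mulrnBr ?(ltnW ab) // e subrr.
  by move=> /(zetaMn_eq0 R _ N0)/dvdn_leq; lia.
have big : forall i j l : nat, (i < j)%N -> (j < l)%N ->
    (l < size (mkseq (fun i => g *+ i) N))%N ->
    cyc (mkseq (fun i => g *+ i) N)`_i (mkseq (fun i => g *+ i) N)`_j
      (mkseq (fun i => g *+ i) N)`_l.
  move=> i j l ij jl; rewrite size_mkseq => lN.
  have jN := ltn_trans jl lN; have iN := ltn_trans ij jN.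
  rewrite !nth_mkseq //; apply/(ext_ord E); try exact: fne.
    exact: fne (ltn_trans ij jl) lN.
  by rewrite !raddfMn gz; apply: zeta_cyc.
case: (N) N1 fne big => [|[|[|N']]] // _ fne big.
by move=> e; apply: (fne 0%N 1%N isT isT); rewrite e.
Qed.

End Residues.

(** * Characteristic sequences *)

(** For every prime power [p ^ n] exactly dividing [N], both residues at [N] reduce to the common
    residue at [p ^ n]; hence [N] divides [k - l], and [k = l] as both are below [N]. *)
Lemma matched_prime_powers (R : realType) (G H : cgroup) (u : G)
    (f : {additive G -> UU R}) (v : H) (h : {additive H -> UU R}) :
  unity_extension u f -> unity_extension v h ->
  (forall p n k, prime p -> (0 < n)%N -> (k < p ^ n)%N ->
     residue u f (p ^ n) k -> residue v h (p ^ n) k) ->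
  forall N, (0 < N)%N -> exists x y, matched u f v h N x y.
Proof.
move=> E F same N N0.
have [k kN rk] := residue_exists E N0; have [l lN rl] := residue_exists F N0.
suff kl : k = l.
  move: rl rk; rewrite -kl => -[y [yz yN]] [x [xz xN]].
  by exists x, y, k.
have : (N %| `|k%:Z - l%:Z|)%N.
  apply/dvdn_partP => // p; rewrite mem_primes => /andP[pp /andP[_ pN]].
  rewrite p_part; set n := logn p N.
  have n0 : (0 < n)%N by rewrite logn_gt0 mem_primes pp N0.
  have pn0 : (0 < p ^ n)%N by rewrite expn_gt0 prime_gt0.
  have [k0 k0p r0] := residue_exists E pn0; have s0 := same _ _ _ pp n0 k0p r0.
  have /dvdnP[M NM] := pfactor_dvdnn p N; rewrite -/n in NM.
  have M0 : (0 < M)%N by case: (M) NM N0 => // ->.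
  rewrite NM in rk rl.
  have e1 := residue_mod E M0 r0 rk; have e2 := residue_mod F M0 s0 rl.
  have: (k%:Z == l%:Z %[mod (p ^ n)%N])%Z by rewrite !modz_nat e1 e2.
  by rewrite eqz_mod_dvd.
have [->|kl] := eqVneq k l; first by [].
by move=> /dvdn_leq; lia.
Qed.

Lemma Dformula_residue (R : realType) (G : cgroup)
    (f : {additive G -> UU R}) p n k :
  unity_extension (unit_elt G) f -> prime p -> (0 < n)%N -> (k < p ^ n)%N ->
  Dformula G p n k <-> residue (unit_elt G) f (p ^ n) k.
Proof.
move=> E pp n0 kp; apply: multiples_residue => //.
by rewrite -(exp1n n) ltn_exp2r // prime_gt1.
Qed.

Lemma characteristic_sequence_exists (R : realType) (G : cgroup)
    (f : {additive G -> UU R}) : unity_extension (unit_elt G) f ->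
  exists phi, characteristic_sequence G phi.
Proof.
move=> E.
have ex (pn : nat * nat) : exists k, prime pn.1 ->
    (k < pn.1 ^ pn.2)%N /\ residue (unit_elt G) f (pn.1 ^ pn.2) k.
  have [pp|pp] := boolP (prime pn.1); last by exists 0%N.
  have [|k ? ?] := residue_exists E (N := (pn.1 ^ pn.2)%N); last by exists k.
  by rewrite expn_gt0 prime_gt0.
have [r rP] := choice ex.
(* The [n]-th digit is the leading base-[p] digit of the residue at [p ^ n]; by [residue_mod] the
   lower digits are those of the residue at [p ^ (n - 1)]. *)
exists (fun p n => (r (p, n) %/ p ^ n.-1)%N) => p pp.
have rlt n : (r (p, n) < p ^ n)%N by have [] := rP (p, n) pp.
have rres n : residue (unit_elt G) f (p ^ n) (r (p, n)).
  by have [] := rP (p, n) pp.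
have p0 := prime_gt0 pp.
split=> [[|n] //= _|n k n0 kp].
  by rewrite ltn_divLR ?expn_gt0 ?p0 // -expnS.
rewrite (Dformula_residue E) //.
have -> : (\sum_(1 <= i < n.+1) r (p, i) %/ p ^ i.-1 * p ^ i.-1)%N = r (p, n).
  elim: n {k n0 kp} => [|n IH].
    by rewrite big_geq //; case: (r _) (rlt 0%N).
  rewrite big_nat_recr //= IH addnC [RHS](divn_eq _ (p ^ n)); congr (_ + _)%N.
  have := rres n.+1; rewrite expnS => /(residue_mod E p0 (rres n)) ->.
  by rewrite modn_small.
by split=> [rk|->//]; apply: (residue_uniq E kp (rlt n)).
Qed.

(** * First-order sentences and invariance under isomorphism *)

Section Formulas.

Definition FTrue n : cformula n := FEq (TZero n) (TZero n).

(** The index ranges over integers outside the language, so the bounded quantifier unfolds to a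
    finite conjunction. *)
Definition FAllBelow n (F : nat -> cformula n) N : cformula n :=
  foldr (fun i => FAnd (F i)) (FTrue n) (iota 0 N).

Definition TMul n (t : cterm n) i : cterm n := iter i (TAdd t) (TZero n).

Lemma teval_TMul (G : cgroup) n (e : 'I_n -> G) t i :
  teval e (TMul t i) = teval e t *+ i.
Proof. by elim: i => [|i IH]; rewrite ?mulr0n //= IH mulrS. Qed.

Lemma fsat_FAllBelow (G : cgroup) n (e : 'I_n -> G) F N :
  fsat (FAllBelow F N) e <-> forall i, (i < N)%N -> fsat (F i) e.
Proof.
rewrite /FAllBelow; have : forall i, (i < N)%N <-> i \in iota 0 N.
  by move=> i; rewrite mem_iota.
move: (iota 0 N) => s sP.
have {sP}sP : (forall i, (i < N)%N -> fsat (F i) e) <->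
    (forall i, i \in s -> fsat (F i) e).
  by split=> h i /sP /h.
rewrite sP; elim: s {sP} => [|a s IH] /=; first by [].
rewrite IH; split=> [[Fa Fs] i|h].
  by rewrite in_cons => /orP[/eqP->|/Fs].
by split=> [|i si]; apply: h; rewrite in_cons ?eqxx ?si ?orbT.
Qed.

Definition cyc_seq_formula n (t : cterm n) N : cformula n :=
  if N == 2 then FNot (FEq (TMul t 0) (TMul t 1))
  else FAllBelow (fun l => FAllBelow (fun j => FAllBelow (fun i =>
    FCyc (TMul t i) (TMul t j) (TMul t l)) j) l) N.

Lemma fsat_cyc_seq (G : cgroup) n (e : 'I_n -> G) t N :
  fsat (cyc_seq_formula t N) e <-> cyc_seq (mkseq (fun i => teval e t *+ i) N).
Proof.
rewrite /cyc_seq_formula; have [->|N2] := eqVneq N 2.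
  by rewrite /= addr0 mulr0n mulr1n.
set s := mkseq _ _.
have -> : cyc_seq s <-> forall i j k : nat,
    (i < j)%N -> (j < k)%N -> (k < size s)%N -> cyc s`_i s`_j s`_k.
  by rewrite {}/s; case: N N2 => [|[|[|N]]].
rewrite fsat_FAllBelow size_mkseq; split=> [h i j l ij jl lN|h l lN].
  have /fsat_FAllBelow/(_ _ jl)/fsat_FAllBelow/(_ _ ij) := h _ lN.
  have jN := ltn_trans jl lN.
  by rewrite /= !teval_TMul !nth_mkseq // (ltn_trans ij).
apply/fsat_FAllBelow => j jl; apply/fsat_FAllBelow => i ij.
have jN := ltn_trans jl lN; have := h _ _ _ ij jl lN.
by rewrite /= !teval_TMul !nth_mkseq // (ltn_trans ij).
Qed.

Definition least_formula : cformula 1 :=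
  FAnd (FNot (FEq (TVar ord0) (TZero 1)))
    (FAll (FImp (FNot (FEq (TVar ord0) (TZero 2)))
      (FImp (FNot (FEq (TVar ord0) (TVar (lift ord0 ord0))))
        (FCyc (TZero 2) (TVar (lift ord0 ord0)) (TVar ord0))))).

(** The language has no symbol for [1_G]; it is introduced as an element satisfying [least_formula],
    unique in a cyclically ordered group. *)
Definition D_sentence p n k : cformula 0 :=
  FEx (FAnd least_formula
    (FEx (FAnd (cyc_seq_formula (TVar ord0) (p ^ n)%N)
      (FEq (TMul (TVar ord0) (p ^ n)%N) (TMul (TVar (lift ord0 ord0)) k))))).

Lemma env_cons0 (G : cgroup) n (x : G) (e : 'I_n -> G) : env_cons x e ord0 = x.
Proof. by rewrite /env_cons unlift_none. Qed.

Lemma env_consS (G : cgroup) n (x : G) (e : 'I_n -> G) i :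
  env_cons x e (lift ord0 i) = e i.
Proof. by rewrite /env_cons liftK. Qed.

Lemma models_D_sentence (G : cgroup) p n k : cyclically_ordered G ->
  (exists u : G, least_nonzero u) ->
  models G (D_sentence p n k) <-> Dformula G p n k.
Proof.
move=> hG [u0 lu0]; have lu := unit_eltP lu0; split.
  move=> [u [[/= u1 u2] [x [/fsat_cyc_seq cx]]]].
  rewrite /= !teval_TMul /= env_consS !env_cons0 in cx u1 * => xN.
  rewrite /Dformula; have <- : u = unit_elt G.
    apply: least_nonzero_unique => //; split=> // y; move: (u2 y).
    by rewrite env_consS !env_cons0.
  by exists x.
move=> [x [cx xN]]; exists (unit_elt G); split; last first.
  exists x; split; last by rewrite /= !teval_TMul /= env_consS !env_cons0.
  by apply/fsat_cyc_seq; rewrite /= env_cons0.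
have [l1 l2] := lu; split=> [|y]; rewrite /= ?env_consS !env_cons0 //.
exact: l2.
Qed.

Lemma cgroup_iso_elementary (G H : cgroup) :
  cgroup_iso G H -> elementarily_equivalent G H.
Proof.
move=> [s [[t sK tK] scyc]].
have steval n (T : cterm n) (e : 'I_n -> G) :
    teval (fun i => s (e i)) T = s (teval e T).
  elim: T => [i||T IH|T IH T' IH'] //=.
  - by rewrite raddf0.
  - by rewrite IH raddfN.
  - by rewrite IH IH' raddfD.
have env n (e : 'I_n -> G) x :
    env_cons (s x) (fun i => s (e i)) = (fun i => s (env_cons x e i)).
  by apply: funext => i; rewrite /env_cons; case: unlift.
have sat n (F : cformula n) (e : 'I_n -> G) :
    fsat F e <-> fsat F (fun i => s (e i)).
  elim: F e => {n} [n T1 T2|n T1 T2 T3|n F IH|n F IH F' IH'|n F IH F' IH'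
    |n F IH F' IH'|n F IH|n F IH] e /=; rewrite ?steval.
  - by split=> [->|/(can_inj sK)].
  - exact: scyc.
  - by rewrite IH.
  - by rewrite IH IH'.
  - by rewrite IH IH'.
  - by rewrite IH IH'.
  (* Surjectivity of [s] lets a quantifier over [H] range over the values [s x]. *)
  - split=> h x; last by apply/IH; rewrite -env.
    by rewrite -(tK x) env; apply/IH.
  - split=> -[x h]; first by exists (s x); rewrite env; apply/IH.
    by exists (t x); apply/IH; rewrite -env tK.
move=> F; rewrite /models sat.
have -> : (fun _ : 'I_0 => s 0) = (fun _ => 0); last by [].
by apply: funext => i; rewrite raddf0.
Qed.

End Formulas.

Local Close Scope ring_scope.

Theorem proposition4p22 (R : realType) (C1 C2 : cgroup)
    (hC1 : cyclically_ordered C1) (hC2 : cyclically_ordered C2)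
    (ndC1 : ~ c_archimedean R C1) (ndC2 : ~ c_archimedean R C2)
    (dC1 : discrete C1) (dC2 : discrete C2)
    (qC1 : cgroup_iso (quot1 C1) (UU R)) (qC2 : cgroup_iso (quot1 C2) (UU R)) :
  [<-> cgroup_iso C1 C2;
       forall p n k : nat, prime p -> 0 < n -> k < p ^ n ->
         Dformula C1 p n k <-> Dformula C2 p n k;
       elementarily_equivalent C1 C2;
       exists phi : nat -> nat -> nat,
         characteristic_sequence C1 phi /\ characteristic_sequence C2 phi].
Proof.
have [f1 E1] := extension_exists hC1 dC1 qC1.
have [f2 E2] := extension_exists hC2 dC2 qC2.
have lC1 := ex_intro (@least_nonzero C1) _ (ext_least E1).
have lC2 := ex_intro (@least_nonzero C2) _ (ext_least E2).
have eeD : elementarily_equivalent C1 C2 ->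
    forall p n k, Dformula C1 p n k <-> Dformula C2 p n k.
  by move=> ee p n k; rewrite -!models_D_sentence //; apply: ee.
have Diso : (forall p n k, prime p -> (0 < n)%N -> (k < p ^ n)%N ->
    Dformula C1 p n k <-> Dformula C2 p n k) -> cgroup_iso C1 C2.
  move=> D; apply: (matched_iso E1 E2); apply: matched_prime_powers => //.
  move=> p n k pp n0 kp.
  by rewrite -(Dformula_residue E1) // -(Dformula_residue E2) // D.
(* The implications run from (1) to (4) and back to (1); those out of (2) and (4) pass through
   [Diso], the other two through [eeD]. *)
tfae.
- by move=> /cgroup_iso_elementary/eeD D p n k _ _ _.
- by move=> /Diso; apply: cgroup_iso_elementary.
- move=> /eeD D; have [phi hphi] := characteristic_sequence_exists E1.
  exists phi; split=> // p pp; have [h1 h2] := hphi p pp; split=> // n k n0 kp.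
  by rewrite -D; apply: h2.
- move=> [phi [h1 h2]]; apply: Diso => p n k pp n0 kp.
  by rewrite (h1 p pp).2 // (h2 p pp).2.
Qed.
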